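(* Let $d\ge 1$ be an integer, $L,\Delta,\delta>0$, $\mathbf{x}_0\in\mathbb{R}^d$, and $L/\sqrt2<\epsilon<L$. The single-direction descent algorithm described in the context returns a $(\delta,\epsilon)$-Goldstein stationary point of every $f\in\mathcal{F}_d(L,\Delta;\mathbf{x}_0)$ within $$2+\frac{\Delta L}{\delta(2\epsilon^2-L^2)}$$ first-order oracle calls.
   Context: All norms are Euclidean; $\mathbb{B}_r(\mathbf{x})$ is the closed ball of radius $r$ about $\mathbf{x}$. Goldstein stationarity. For locally Lipschitz $f:\mathbb{R}^d\to\mathbb{R}$, $f^\circ(\mathbf{x};\mathbf{v})=\limsup_{\mathbf{y}\to\mathbf{x},\,t\downarrow 0}\frac{f(\mathbf{y}+t\mathbf{v})-f(\mathbf{y})}{t}$, the Clarke subdifferential is $\partial f(\mathbf{x})=\{\mathbf{g}:\langle\mathbf{g},\mathbf{v}\rangle\le f^\circ(\mathbf{x};\mathbf{v})\ \forall\mathbf{v}\in\mathbb{R}^d\}$, and the Goldstein subdifferential is $\partial_\delta f(\mathbf{x})=\mathrm{conv}\big(\bigcup_{\mathbf{y}\in\mathbb{B}_\delta(\mathbf{x})}\partial f(\mathbf{y})\big)$. A point $\mathbf{x}$ is $(\delta,\epsilon)$-Goldstein stationary if $\inf_{\mathbf{g}\in\partial_\delta f(\mathbf{x})}\|\mathbf{g}\|\le\epsilon$. Function class. $\mathcal{F}_d(L,\Delta;\mathbf{x}_0)$ is the set of all $f:\mathbb{R}^d\to\mathbb{R}$ with $|f(\mathbf{x})-f(\mathbf{y})|\le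 L\|\mathbf{x}-\mathbf{y}\|$ for all $\mathbf{x},\mathbf{y}$, $\inf f>-\infty$, and $f(\mathbf{x}_0)-\inf f\le\Delta$. First-order oracle. A call at $\mathbf{x}$ returns $f(\mathbf{x})$ and one Clarke subgradient $\mathbf{g}\in\partial f(\mathbf{x})$; the guarantee is for every valid selection of subgradients by the oracle. Every call, including the initial one, is counted. Exact real arithmetic and comparisons are used. Single-direction descent algorithm (inputs $L,\delta>0$, $L/\sqrt2<\epsilon<L$, $\mathbf{x}_0$). Set $s_{\mathrm{dec}}=(2\epsilon^2-L^2)/L$. Query $(f(\mathbf{x}_0),\mathbf{g}_0)$ and set $\mathbf{x}=\mathbf{x}_0$, $a=f(\mathbf{x}_0)$, $\mathbf{g}=\mathbf{g}_0$. Then loop: (1) if $\|\mathbf{g}\|\le\epsilon$, return $\mathbf{x}$; (2) set $\mathbf{y}=\mathbf{x}-\delta\mathbf{g}/\|\mathbf{g}\|$ and query $b=f(\mathbf{y})$ and a subgradient $\mathbf{g}_{\mathbf{y}}\in\partial f(\mathbf{y})$; (3) if $a-b\le\delta s_{\mathrm{dec}}$, return $\mathbf{x}$; (4) otherwise set $\mathbf{x}\leftarrow\mathbf{y}$, $a\leftarrow b$, $\mathbf{g}\leftarrow\mathbf{g}_{\mathbf{y}}$ and repeat. *)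

(* Defs.v *)
From HB Require Import structures.
From mathcomp Require Import all_boot all_order all_algebra.
From mathcomp Require Import all_classical all_reals all_analysis.
Set Implicit Arguments.
Unset Strict Implicit.
Unset Printing Implicit Defensive.
Import Order.TTheory GRing.Theory Num.Theory.
Import numFieldNormedType.Exports.
Local Open Scope classical_set_scope.
Local Open Scope ring_scope.

Section Euclidean.
Variables (R : realType) (d : nat).
Implicit Types x y u v g : 'rV[R]_d.

Definition dot u v : R := \sum_(i < d) u 0 i * v 0 i.

(* The library's norm on row vectors is the sup norm. *)
Definition enorm u : R := Num.sqrt (dot u u).

Definition eball (r : R) x : set 'rV[R]_d := [set y | enorm (y - x) <= r].

Definition convex_hull (A : set 'rV[R]_d) : set 'rV[R]_d :=
  smallest (@convex_set R 'rV[R]_d) A.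

End Euclidean.

Section Goldstein.
Variables (R : realType) (d : nat).
Implicit Types (f : 'rV[R]_d -> R) (x v : 'rV[R]_d).

(* [nbhs x] is the sup-norm neighbourhood filter, which coincides with the
   Euclidean one; it does not exclude y = x. The value is extended real. *)
Definition clarke_dd f x v : \bar R :=
  limf_esup (fun p : 'rV[R]_d * R => ((f (p.1 + p.2 *: v) - f p.1) / p.2)%:E)
            (filter_prod (nbhs x) (0 : R)^'+).

Definition clarke_subdiff f x : set 'rV[R]_d :=
  [set g | forall v, ((dot g v)%:E <= clarke_dd f x v)%E].

Definition goldstein_subdiff (delta : R) f x : set 'rV[R]_d :=
  convex_hull (\bigcup_(y in eball delta x) clarke_subdiff f y).

(* The infimum is taken in \bar R, where the infimum of set0 is +oo. *)
Definition goldstein_stationary (delta eps : R) f x : Prop :=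
  (ereal_inf [set (enorm g)%:E | g in goldstein_subdiff delta f x] <= eps%:E)%E.

Definition fclass (L Delta : R) (x0 : 'rV[R]_d) : set ('rV[R]_d -> R) :=
  [set f | [/\ forall x y, `|f x - f y| <= L * enorm (x - y),
               has_lbound (range f)
             & f x0 - inf (range f) <= Delta]].

End Goldstein.

Section Algorithm.
Variables (R : realType) (d : nat).

(* [O k x] is the answer (value, subgradient) to a query at x made as the k-th
   call, counted from 0. Letting the answer depend on k covers oracles that
   adapt to the history, and answer repeated queries inconsistently: the
   algorithm is deterministic, so a run only ever sees one history. *)
Definition oracle : Type := nat -> 'rV[R]_d -> R * 'rV[R]_d.

Definition valid_oracle (f : 'rV[R]_d -> R) (O : oracle) : Prop :=
  forall k x, (O k x).1 = f x /\ (O k x).2 \in clarke_subdiff f x.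

(* The first argument is the number of oracle calls made so far. *)
Variant sdd_state : Type :=
  | Running of nat & 'rV[R]_d & R & 'rV[R]_d
  | Returned of nat & 'rV[R]_d.

Definition sdd_sdec (L eps : R) : R := (2 * eps ^+ 2 - L ^+ 2) / L.

Definition sdd_init (O : oracle) (x0 : 'rV[R]_d) : sdd_state :=
  let: (a, g) := O 0%N x0 in Running 1 x0 a g.

Definition sdd_step (L delta eps : R) (O : oracle) (s : sdd_state) : sdd_state :=
  match s with
  | Returned _ _ => s
  | Running n x a g =>
      if enorm g <= eps then Returned n x else
      let y := x - (delta / enorm g) *: g in
      let: (b, gy) := O n y in
      if a - b <= delta * sdd_sdec L eps then Returned n.+1 x
      else Running n.+1 y b gy
  end.

Definition sdd_returns (L delta eps : R) (O : oracle) (x0 : 'rV[R]_d)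
    (n : nat) (x : 'rV[R]_d) : Prop :=
  exists k, iter k (sdd_step L delta eps O) (sdd_init O x0) = Returned n x.

End Algorithm.

(* Main.v *)
Require Import Defs.
From HB Require Import structures.
From mathcomp Require Import all_boot all_order all_algebra.
From mathcomp Require Import all_classical all_reals all_analysis.
From mathcomp Require Import ring lra.
Import Order.TTheory GRing.Theory Num.Theory.
Import numFieldNormedType.Exports.
Local Open Scope classical_set_scope.
Local Open Scope ring_scope.

(** The oracle budget comes from the value of [f]: every continued iteration
    lowers it by more than [delta * s] with [s = (2 eps^2 - L^2) / L > 0], while
    the total possible decrease is at most [Delta]. So at most
    [Delta / (delta * s)] iterations continue, and the initial query and the
    query of the rejected trial point account for the additive [2]
    ([sdd_progress]).

    The point is correctness of a return after insufficient decrease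
    ([goldstein_stationary_of_small_decrease]). Let [g] be the subgradient at
    [x], with [eps < |g|], and [u = g / |g|]. If [f x - f (x - delta u)] is at
    most [delta * s], a mean value theorem gives a point [z] of the segment from
    [x] to [x - delta u] and [h] in the subdifferential at [z] with
    [<h, u> <= s]. Both [g] and [h] have norm at most [L], so the midpoint
    [(g + h) / 2], which lies in the Goldstein subdifferential, satisfies
    [|(g + h) / 2|^2 <= (2 L^2 + 2 |g| s) / 4 <= (L^2 + L s) / 2 = eps^2].

    The mean value theorem is obtained in two halves.
    - [clarke_mean_value]: bisect the segment from [x] to [x + v], each time
      keeping a half on which the average slope of [f] is at least the original
      one. The halves shrink to a point [z], and since the Clarke derivative is
      a limsup over moving base points as well as over step lengths, the kept
      halves themselves witness that it is at least [f (x + v) - f x] at [z].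
    - [clarke_subdiff_attains]: for Lipschitz [f] the Clarke derivative is a
      finite sublinear function of the direction, hence is attained by one of
      its linear minorants. This is the finite-dimensional Hahn-Banach theorem
      [sublinear_le_dot]. *)

(** * Euclidean geometry of row vectors *)

Lemma dotC {R : realType} {d} (u v : 'rV[R]_d) : dot u v = dot v u.
Proof. by apply: eq_bigr => i _; rewrite mulrC. Qed.

Lemma dotDl {R : realType} {d} (u v w : 'rV[R]_d) :
  dot (u + v) w = dot u w + dot v w.
Proof. by rewrite -big_split; apply: eq_bigr => i _; rewrite mxE mulrDl. Qed.

Lemma dotZl {R : realType} {d} a (u v : 'rV[R]_d) : dot (a *: u) v = a * dot u v.
Proof. by rewrite mulr_sumr; apply: eq_bigr => i _; rewrite mxE mulrA. Qed.

Lemma dotDr {R : realType} {d} (u v w : 'rV[R]_d) :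
  dot u (v + w) = dot u v + dot u w.
Proof. by rewrite dotC dotDl !(dotC u). Qed.

Lemma dotZr {R : realType} {d} a (u v : 'rV[R]_d) : dot u (a *: v) = a * dot u v.
Proof. by rewrite dotC dotZl dotC. Qed.

Lemma dotNr {R : realType} {d} (u v : 'rV[R]_d) : dot u (- v) = - dot u v.
Proof. by rewrite -scaleN1r dotZr mulN1r. Qed.

Lemma dot_ge0 {R : realType} {d} (u : 'rV[R]_d) : 0 <= dot u u.
Proof. by apply: sumr_ge0 => i _; rewrite -expr2 sqr_ge0. Qed.

Lemma dotvv {R : realType} {d} (u : 'rV[R]_d) : dot u u = enorm u ^+ 2.
Proof. by rewrite sqr_sqrtr ?dot_ge0. Qed.

Lemma enorm_ge0 {R : realType} {d} (u : 'rV[R]_d) : 0 <= enorm u.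
Proof. exact: sqrtr_ge0. Qed.

Lemma enormZ {R : realType} {d} a (u : 'rV[R]_d) : enorm (a *: u) = `|a| * enorm u.
Proof.
by rewrite /enorm dotZl dotZr mulrA -expr2 sqrtrM ?sqr_ge0// sqrtr_sqr.
Qed.

Lemma enorm_eq0 {R : realType} {d} (u : 'rV[R]_d) : enorm u = 0 -> u = 0.
Proof.
move=> u0; have : dot u u = 0 by rewrite dotvv u0 expr0n.
move/psumr_eq0P => h; apply/rowP => i; rewrite mxE.
by apply/eqP; rewrite -sqrf_eq0 expr2 h// => j _; rewrite -expr2 sqr_ge0.
Qed.

(** Cauchy-Schwarz: the squared norm of [|v| u - |u| v] is
    [2 |u| |v| (|u| |v| - <u, v>)]. *)
Lemma dot_le_enorm {R : realType} {d} (u v : 'rV[R]_d) :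
  dot u v <= enorm u * enorm v.
Proof.
have [u0|u0] := eqVneq (enorm u) 0.
  by rewrite u0 (enorm_eq0 _ u0) mul0r -(scale0r 0) dotZl mul0r.
have [v0|v0] := eqVneq (enorm v) 0.
  by rewrite v0 (enorm_eq0 _ v0) mulr0 -(scale0r 0) dotZr mul0r.
have uv0 : 0 < enorm u * enorm v by rewrite mulr_gt0// lt0r ?u0 ?v0 enorm_ge0.
have := dot_ge0 (enorm v *: u - enorm u *: v).
rewrite -scaleNr !(dotDl, dotDr, dotZl, dotZr) !dotvv (dotC v u) => h.
rewrite -(ler_pM2l uv0); nra.
Qed.

(** * Linear minorants of sublinear functions *)

(** Only the inequality is asked for positive scalars, because the reverse one
    follows by applying it to the inverse scalar ([sublinearZ]). *)
Definition sublinear {R : realType} {V : lmodType R} (p : V -> R) : Prop :=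
  (forall u v, p (u + v) <= p u + p v) /\
  (forall a v, 0 < a -> p (a *: v) <= a * p v).

Section Sublinear.
Context {R : realType} {V : lmodType R}.
Implicit Types (p q : V -> R) (a : R) (u v w : V).

Lemma sublinearZ p a v : sublinear p -> 0 < a -> p (a *: v) = a * p v.
Proof.
move=> [_ pZ] a0; apply/eqP; rewrite eq_le pZ//=.
by rewrite -ler_pdivlMl// -{1}(scalerK (lt0r_neq0 a0) v) pZ ?invr_gt0.
Qed.

Lemma sublinear0 p : sublinear p -> p 0 = 0.
Proof.
by move=> sp; have := sublinearZ p 2 0 sp (ltr0Sn _ 1); rewrite scaler0; lra.
Qed.

Lemma sublinearN p v : sublinear p -> - p (- v) <= p v.
Proof. by move=> sp; have := sp.1 v (- v); rewrite subrr sublinear0//; lra. Qed.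

(** The one-step extension of Hahn-Banach in a form that never leaves the whole
    space: [q w], the infimum over [t >= 0] of [p (w + t v) - t p v], is again
    sublinear and is linear along [v], because [q (- v) = - p v] forces
    [q v = p v = - q (- v)]. *)
Lemma sublinear_flatten p v : sublinear p ->
  exists q, [/\ sublinear q, forall w, q w <= p w & q (- v) = - p v].
Proof.
move=> sp; have [pD pZ] := sp.
pose E w := [set p (w + t *: v) - t * p v | t in [set t | 0 <= t]].
have pv t : 0 <= t -> p (t *: v) = t * p v.
  rewrite le_eqVlt => /predU1P[<-|t0]; last exact: sublinearZ.
  by rewrite scale0r mul0r sublinear0.
have Elb w : lbound (E w) (- p (- w)).
  move=> _ [t /= t0 <-]; have := pD (w + t *: v) (- w).
  by rewrite addrC addKr pv//; lra.
have qle w t : 0 <= t -> inf (E w) <= p (w + t *: v) - t * p v.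
  by move=> t0; apply: ge_inf; [exists (- p (- w)); exact: Elb|exists t].
have infge w c : (forall t, 0 <= t -> c <= p (w + t *: v) - t * p v) -> c <= inf (E w).
  move=> h; apply: lb_le_inf; first by exists (p (w + 0 *: v) - 0 * p v), 0 => /=.
  by move=> _ [t t0 <-]; exact: h.
exists (fun w => inf (E w)); split.
- split=> [u w|a w a0] /=.
  + rewrite -lerBlDr; apply: (infge _) => s s0.
    rewrite lerBlDr -lerBlDl; apply: (infge _) => t t0.
    rewrite lerBlDl (le_trans (qle _ (s + t) _)) ?addr_ge0//.
    have := pD (u + s *: v) (w + t *: v).
    by rewrite addrACA -scalerDl; lra.
  + rewrite -ler_pdivrMl//; apply: (infge _) => t t0; rewrite ler_pdivrMl//.
    rewrite (le_trans (qle _ (a * t) _)) ?mulr_ge0 ?(ltW a0)//.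
    by rewrite -scalerA -scalerDr mulrBr mulrA lerB// pZ.
- by move=> w; apply: le_trans (qle w 0 (lexx 0)) _; rewrite scale0r addr0; lra.
- apply/eqP; rewrite eq_le; apply/andP; split.
    apply: le_trans (qle _ 1 ler01) _.
    by rewrite scale1r addNr sublinear0//; lra.
  by rewrite -{1}[v]opprK; apply: (infge _) => t t0; apply: Elb; exists t.
Qed.

(** Flattening along further vectors preserves what is gained: if [q <= p1] are
    sublinear and [p1 (- v) = - p1 v], then
    [q (- v) <= - p1 v <= - q v <= q (- v)]. *)
Lemma sublinear_flatten_seq p (vs : seq V) : sublinear p ->
  exists q, [/\ sublinear q, forall w, q w <= p w &
                {in vs, forall v, q (- v) = - q v}].
Proof.
elim: vs p => [|v vs IH] p sp; first by exists p; split.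
have [p1 [sp1 p1p p1v]] := sublinear_flatten p v sp.
have [q [sq qp1 qvs]] := IH p1 sp1.
exists q; split=> // [w|w]; first exact: le_trans (qp1 w) (p1p w).
rewrite inE => /predU1P[->|]; last exact: qvs.
apply/eqP; rewrite eq_le -[X in _ && X]lerN2 opprK.
have := sublinearN q v sq; have := sublinearN q (- v) sq.
have := qp1 (- v); have := qp1 v; have := p1p v.
by rewrite p1v opprK; lra.
Qed.

End Sublinear.

(** Hahn-Banach in finite dimension. Flattening first along [v] secures the value
    at [v], and flattening then along the canonical basis produces a sublinear
    function that is linear along each coordinate axis, which is a dot product. *)
Lemma sublinear_le_dot {R : realType} {d} (p : 'rV[R]_d -> R) v : sublinear p ->
  exists g, (forall w, dot g w <= p w) /\ dot g v = p v.
Proof.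
move=> sp; have [p1 [sp1 p1p p1v]] := sublinear_flatten p v sp.
have [q [sq qp1 qe]] :=
  sublinear_flatten_seq p1 [seq delta_mx 0 i | i <- enum 'I_d] sp1.
have {}qe i : q (- delta_mx 0 i) = - q (delta_mx 0 i).
  by apply: qe; apply/map_f; rewrite mem_enum.
have qdot w : q w <= dot (\row_i q (delta_mx 0 i)) w.
  rewrite {1}[w]row_sum_delta /dot.
  elim/big_ind2: _ => [|u a v' b ua vb|i _]; first by rewrite sublinear0.
    by apply: le_trans (sq.1 _ _) _; exact: lerD.
  rewrite mxE; have [w0|w0|->] := ltgtP (w 0 i) 0.
  - rewrite -[w 0 i]opprK scaleNr -scalerN (sublinearZ q) ?oppr_gt0// qe; lra.
  - by rewrite (sublinearZ q)// mulrC.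
  - by rewrite scale0r mulr0 sublinear0.
(* Applied to [- w], the bound [qdot] gives [dot g w <= - q (- w) <= q w], so [q]
   equals the dot product. *)
exists (\row_i q (delta_mx 0 i)); split=> [w|].
  have := qdot (- w); have := sublinearN q w sq.
  have := qp1 w; have := p1p w; rewrite dotNr; lra.
have := qdot v; have := qdot (- v); have := sublinearN q v sq.
have := sublinearN q (- v) sq.
have := qp1 v; have := p1p v; have := qp1 (- v).
by rewrite p1v dotNr opprK => *; apply/eqP; rewrite eq_le; apply/andP; split; lra.
Qed.

(** * The Clarke directional derivative *)

(** Bisection: the average slope over an interval is the mean of the average
    slopes over its halves, so one of the halves is at least as steep. The
    [n]-th interval kept is [[a n, a n + 2^-n]]. *)
Lemma steep_subintervals {R : realType} (phi : R -> R) c : c <= phi 1 - phi 0 ->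
  exists a : nat -> R, [/\ {homo a : m n / (m <= n)%N >-> m <= n},
    forall n, 0 <= a n /\ a n + 2^-1 ^+ n <= 1 &
    forall n, c * 2^-1 ^+ n <= phi (a n + 2^-1 ^+ n) - phi (a n)].
Proof.
move=> c01; pose h n : R := 2^-1 ^+ n.
have hS n : h n = h n.+1 + h n.+1 by rewrite /h exprS; lra.
have h0 n : 0 < h n by rewrite exprn_gt0.
pose step n (s : R) :=
  if c * h n.+1 <= phi (s + h n.+1) - phi s then s else s + h n.+1.
pose a := fix a n := if n is k.+1 then step k (a k) else 0.
have aS n : a n <= a n.+1 <= a n + h n.+1.
  by rewrite /= /step; case: ifP => _; rewrite lexx lerDl ltW.
have a_homo : {homo a : m n / (m <= n)%N >-> m <= n}.
  by apply: homo_leq => [//||n]; [exact: le_trans|have /andP[] := aS n].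
exists a; split=> // n; first last.
  rewrite -/(h n); elim: n => [|n IH].
    by rewrite /h expr0 mulr1 add0r.
  rewrite /= /step -/(h n.+1); case: ifPn => //.
  rewrite -ltNge => lt; move: IH; rewrite (hS n) mulrDr addrA; lra.
rewrite -/(h n); elim: n => [|n [a0 a1]]; first by rewrite /h expr0 add0r.
have /andP[a2 a3] := aS n; have := hS n.
by split; lra.
Qed.

Definition enorm_lipschitz {R : realType} {d} (L : R) (f : 'rV[R]_d -> R) : Prop :=
  forall y z, `|f y - f z| <= L * enorm (y - z).

Section Clarke.
Context {R : realType} {d : nat}.
Implicit Types (f : 'rV[R]_d -> R) (x v : 'rV[R]_d) (L : R).

(** The quotient whose upper limit is [clarke_dd]. *)
Definition dquot f v (p : 'rV[R]_d * R) : R := (f (p.1 + p.2 *: v) - f p.1) / p.2.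

Lemma cvg_right0 {T : Type} {F : set_system T} {FF : Filter F} (g : T -> R) :
  g t @[t --> F] --> (0 : R) -> (\forall t \near F, 0 < g t) ->
  g t @[t --> F] --> (0 : R)^'+.
Proof.
move=> g0 gpos B; rewrite /at_right /within /= => /g0 hB.
by apply: filterS2 gpos hB => t /= t0; apply.
Qed.

Lemma le_clarke_dd f x v c :
  (forall A, filter_prod (nbhs x) (0 : R)^'+ A -> exists2 p, A p & c <= dquot f v p) ->
  (c%:E <= clarke_dd f x v)%E.
Proof.
move=> h; apply/ereal_infP => _ [A /h[p Ap cp] <-].
by apply: (@le_trans _ _ (dquot f v p)%:E); [rewrite lee_fin|apply: ereal_sup_ubound; exists p].
Qed.

Lemma clarke_dd_le f x v c :
  (\forall p \near filter_prod (nbhs x) (0 : R)^'+, dquot f v p <= c) ->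
  (clarke_dd f x v <= c%:E)%E.
Proof.
move=> h; apply: (@le_trans _ _ (ereal_sup [set (dquot f v p)%:E | p in [set p | dquot f v p <= c]])).
  apply: ereal_inf_lbound; exists [set p | dquot f v p <= c] => //.
by apply/ereal_supP => _ [p /= pc <-]; rewrite lee_fin.
Qed.

Lemma clarke_dd_lt f x v c : (clarke_dd f x v < c%:E)%E ->
  \forall p \near filter_prod (nbhs x) (0 : R)^'+, dquot f v p < c.
Proof.
move=> /ereal_inf_lt[_ [A FA <-] sc]; apply: filterS FA => p Ap.
by rewrite -lte_fin; apply: le_lt_trans sc; apply: ereal_sup_ubound; exists p.
Qed.

Lemma near_step_gt0 x : \forall p \near filter_prod (nbhs x) (0 : R)^'+, 0 < p.2.
Proof.
exists (setT, [set t | 0 < t]); last by move=> [y t] [].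
by split; [exact: filterT|exact: nbhs_right_gt].
Qed.

(** Reparametrising base point and step length by [(y, t)] to [(y + t w, a t)]
    respects the base of the Clarke limsup. The shift by [t w] underlies
    subadditivity in the direction, the factor [a] positive homogeneity. *)
Lemma near_shear x w a (P : set ('rV[R]_d * R)) : 0 < a ->
  filter_prod (nbhs x) (0 : R)^'+ P ->
  \forall p \near filter_prod (nbhs x) (0 : R)^'+, P (p.1 + p.2 *: w, a * p.2).
Proof.
move=> a0.
have snd0 : p.2 @[p --> filter_prod (nbhs x) (0 : R)^'+] --> (0 : R).
  by apply: cvg_trans cvg_snd _; exact: cvg_within.
have fst_cvg : p.1 + p.2 *: w @[p --> filter_prod (nbhs x) (0 : R)^'+] --> x.
  have := cvgD (cvg_fst : p.1 @[p --> filter_prod (nbhs x) (0 : R)^'+] --> x)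
    (cvgZr_tmp (a := w) snd0).
  by rewrite scale0r addr0; apply.
have snd_cvg : a * p.2 @[p --> filter_prod (nbhs x) (0 : R)^'+] --> (0 : R)^'+.
  apply: cvg_right0; first by have := cvgMl_tmp (a := a) snd0; rewrite mulr0; apply.
  have := near_step_gt0 x.
  by apply: filterS => p p0; rewrite mulr_gt0.
by move=> FP; have := cvg_pair fst_cvg snd_cvg FP; apply.
Qed.

(** All difference quotients with positive step lie between [- L |v|] and
    [L |v|]. *)
Lemma clarke_dd_fin f L x v : enorm_lipschitz L f ->
  clarke_dd f x v \is a fin_num /\ (clarke_dd f x v <= (L * enorm v)%:E)%E.
Proof.
move=> lip.
have q : \forall p \near filter_prod (nbhs x) (0 : R)^'+, `|dquot f v p| <= L * enorm v.
  have := near_step_gt0 x.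
  apply: filterS => p p0.
  rewrite /dquot normrM normfV (gtr0_norm p0) ler_pdivrMr// (le_trans (lip _ _))//.
  by rewrite addrC addKr enormZ (gtr0_norm p0) mulrCA mulrC.
have dd_le : (clarke_dd f x v <= (L * enorm v)%:E)%E.
  by apply: clarke_dd_le; apply: filterS q => p /ler_normlP[_].
split=> //; rewrite fin_numE -ltey -ltNye (le_lt_trans dd_le) ?ltry// andbT.
apply: (@lt_le_trans _ _ (- (L * enorm v))%:E); first exact: ltNyr.
apply: le_clarke_dd => A FA.
have [p [Ap qp]] := filter_ex (filterI FA q).
by exists p => //; move: qp; rewrite ler_norml => /andP[].
Qed.

(** Subadditivity splits the increment along [t (v + w)] at [y + t w] and uses
    that the first piece is still a difference quotient based near [x]. *)
Lemma clarke_dd_sublinear f L x : enorm_lipschitz L f ->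
  sublinear (fun v => fine (clarke_dd f x v)).
Proof.
move=> lip; have fin v := (clarke_dd_fin f L x v lip).1.
have lt_fine v e : 0 < e -> (clarke_dd f x v < (fine (clarke_dd f x v) + e)%:E)%E.
  by move=> e0; rewrite -{1}(fineK (fin v)) lte_fin ltrDl.
have fine_le v c :
    (\forall p \near filter_prod (nbhs x) (0 : R)^'+, dquot f v p <= c) ->
    fine (clarke_dd f x v) <= c.
  by move=> /clarke_dd_le; rewrite -{1}(fineK (fin v)) lee_fin.
split=> [v w|a v a0].
- apply/ler_addgt0Pr => e e0; apply: fine_le.
  have e20 : 0 < e / 2 by rewrite divr_gt0.
  have qv := near_shear x w 1 _ ltr01 (clarke_dd_lt _ _ _ _ (lt_fine v _ e20)).
  have qw := clarke_dd_lt _ _ _ _ (lt_fine w _ e20).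
  apply: filterS2 qv qw => -[y t]; rewrite /dquot /= mul1r.
  rewrite (scalerDr t v w) (addrC (t *: v)) addrA => h1 h2.
  have -> : f (y + t *: w + t *: v) - f y =
    (f (y + t *: w + t *: v) - f (y + t *: w)) + (f (y + t *: w) - f y) by lra.
  rewrite mulrDl; lra.
- apply/ler_addgt0Pr => e e0; apply: fine_le.
  have ea0 : 0 < e / a by rewrite divr_gt0.
  have qv := near_shear x 0 a _ a0 (clarke_dd_lt _ _ _ _ (lt_fine v _ ea0)).
  apply: filterS qv => -[y t]; rewrite /dquot /= scaler0 addr0 scalerA (mulrC t).
  rewrite invfM mulrCA ltr_pdivrMl// mulrDr (mulrC a (e / a)) divfK ?gt_eqF//.
  exact: ltW.
Qed.

(** The linear minorants of [clarke_dd f x] are exactly the Clarke subgradients,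
    so the support property of sublinear functions yields one that is tight in
    the direction [v]. *)
Lemma clarke_subdiff_attains f L x v : enorm_lipschitz L f ->
  exists2 g, clarke_subdiff f x g & clarke_dd f x v = (dot g v)%:E.
Proof.
move=> lip; have fin w := (clarke_dd_fin f L x w lip).1.
have [g [gle gv]] := sublinear_le_dot _ v (clarke_dd_sublinear f L x lip).
exists g; last by rewrite gv fineK.
by move=> w; rewrite -(fineK (fin w)) lee_fin.
Qed.

(** Test the subgradient inequality in the direction [g] itself. *)
Lemma clarke_subdiff_enorm f L x g : enorm_lipschitz L f -> 0 <= L ->
  clarke_subdiff f x g -> enorm g <= L.
Proof.
move=> lip L0 /(_ g) /le_trans /(_ (clarke_dd_fin f L x g lip).2).
rewrite lee_fin dotvv expr2; have [->//|g0] := eqVneq (enorm g) 0.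
by rewrite ler_pM2r// lt0r g0 enorm_ge0.
Qed.

(** The dyadic intervals of [steep_subintervals] converge to one point, and their
    difference quotients, with left endpoints as moving base points, all
    reach [f (x + v) - f x]. *)
Lemma clarke_mean_value f x v : exists2 t, 0 <= t <= 1 &
  ((f (x + v) - f x)%:E <= clarke_dd f (x + t *: v) v)%E.
Proof.
have [|a [a_homo a01 slope]] :=
    steep_subintervals (fun t => f (x + t *: v)) (f (x + v) - f x).
  by rewrite /= scale1r scale0r addr0.
have h0 n : 0 < 2^-1 ^+ n :> R by rewrite exprn_gt0.
have cvga : cvgn a.
  apply: nondecreasing_is_cvgn => //; exists 1 => _ [n _ <-].
  by have := a01 n; have := h0 n; lra.
exists (limn a).
  apply/andP; split.
    by apply: limr_ge => //; near=> n; exact: (a01 n).1.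
  by apply: limr_le => //; near=> n; have := a01 n; have := h0 n; lra.
apply: le_clarke_dd => A.
have pc : x + a n *: v @[n --> \oo] --> x + limn a *: v.
  by apply: cvgD; [exact: cvg_cst|exact: cvgZr_tmp].
have hc : 2^-1 ^+ n @[n --> \oo] --> (0 : R)^'+.
  apply: cvg_right0; last by near=> n.
  by apply: cvg_expr; rewrite ger0_norm; lra.
move=> FA; have : \forall n \near \oo, A (x + a n *: v, 2^-1 ^+ n).
  exact: (cvg_pair pc hc FA).
move=> /filter_ex[n An].
exists (x + a n *: v, 2^-1 ^+ n) => //.
by rewrite /dquot /= ler_pdivlMr// -addrA -scalerDl.
Unshelve. all: by end_near. Qed.

End Clarke.

(** * Certificates of Goldstein stationarity *)

Section Goldstein.
Context {R : realType} {d : nat}.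
Implicit Types (f : 'rV[R]_d -> R) (x g h : 'rV[R]_d).

Lemma goldstein_stationary_of_mem delta eps f x g :
  goldstein_subdiff delta f x g -> enorm g <= eps -> goldstein_stationary delta eps f x.
Proof.
move=> gG ge; apply: (@le_trans _ _ (enorm g)%:E); last by rewrite lee_fin.
by apply: ereal_inf_lbound; exists g.
Qed.

Lemma goldstein_stationary_near delta eps f x y g :
  eball delta x y -> clarke_subdiff f y g -> enorm g <= eps ->
  goldstein_stationary delta eps f x.
Proof.
move=> xy yg; apply: goldstein_stationary_of_mem.
by apply: sub_smallest (@subset_refl _ _) _ _; exists y.
Qed.

Lemma convex_hull_midpoint (A : set 'rV[R]_d) g h :
  A g -> A h -> convex_hull A (2^-1 *: (g + h)).
Proof.
move=> Ag Ah C [Cconv AC].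
have half0 : 0 <= 2^-1 :> R by lra.
have half1 : 2^-1 <= 1 :> R by lra.
have := Cconv g h (Itv01 half0 half1) (mem_set (AC _ Ag)) (mem_set (AC _ Ah)).
move=> /set_mem; congr (C _); rewrite scalerDr; congr (_ + _ *: _).
by rewrite /unstable.onem /=; lra.
Qed.

(** A step of length [delta] against [g] that fails to decrease [f] enough
    reveals a second subgradient [h] nearby which makes a large angle with [g]
    or is small. Then the midpoint of [g] and [h] is short. *)
Lemma goldstein_stationary_of_small_decrease f L delta eps x g :
  enorm_lipschitz L f ->
  0 < L -> 0 < delta -> 0 < eps -> 0 <= 2 * eps ^+ 2 - L ^+ 2 ->
  clarke_subdiff f x g -> eps < enorm g ->
  f x - f (x - (delta / enorm g) *: g) <= delta * sdd_sdec L eps ->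
  goldstein_stationary delta eps f x.
Proof.
move=> lip L0 delta0 eps0 s0 xg g_eps dec.
have ng0 : 0 < enorm g by exact: lt_trans g_eps.
have gL : enorm g <= L := clarke_subdiff_enorm f L x g lip (ltW L0) xg.
set v := - ((delta / enorm g) *: g).
have v_norm : enorm v = delta.
  rewrite /v -scaleNr enormZ normrN ger0_norm ?divr_ge0 ?ltW//.
  by rewrite divfK// gt_eqF.
have [t /andP[t0 t1] mv] := clarke_mean_value f x v.
have [h zh dd] := clarke_subdiff_attains f L (x + t *: v) v lip.
have hL : enorm h <= L := clarke_subdiff_enorm f L _ h lip (ltW L0) zh.
have zball : eball delta x (x + t *: v).
  rewrite /eball /= addrC addKr enormZ v_norm ger0_norm//; nra.
have xball : eball delta x x.
  by rewrite /eball /= subrr -(scale0r 0) enormZ normr0 mul0r ltW.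
have gh : dot g h <= 2 * eps ^+ 2 - L ^+ 2.
  move: mv; rewrite dd lee_fin /v dotNr dotZr (dotC h) => mv.
  have : delta / enorm g * dot g h <= delta * sdd_sdec L eps by lra.
  rewrite -mulrA ler_pM2l// mulrC ler_pdivrMr// => /le_trans; apply.
  by rewrite /sdd_sdec -mulrA ler_piMr// ler_pdivrMl// mulr1.
apply: (goldstein_stationary_of_mem _ _ _ _ (2^-1 *: (g + h))).
  by apply: convex_hull_midpoint; [exists x|exists (x + t *: v)].
rewrite -(ler_pXn2r (n := 2))// ?nnegrE ?enorm_ge0 ?(ltW eps0)//.
rewrite -dotvv !(dotZl, dotZr, dotDl, dotDr) !dotvv (dotC h).
have : enorm g ^+ 2 <= L ^+ 2 by rewrite ler_pXn2r ?nnegrE ?enorm_ge0 ?(ltW L0).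
have : enorm h ^+ 2 <= L ^+ 2 by rewrite ler_pXn2r ?nnegrE ?enorm_ge0 ?(ltW L0).
lra.
Qed.

End Goldstein.

(** * The run of the algorithm *)

(** The invariant of the loop. While running, [k] continued iterations have used
    [k + 1] calls and lowered [f] by at least [k] times the required decrease.
    A run that stops after [m] continued iterations has made one call more if
    its last trial point was rejected, hence at most [m + 2]. *)
Lemma sdd_progress {R : realType} {d} (L delta eps : R) f (O : oracle R d) x0 :
  enorm_lipschitz L f ->
  0 < L -> 0 < delta -> 0 < eps -> 0 <= 2 * eps ^+ 2 - L ^+ 2 ->
  valid_oracle f O ->
  forall k,
  (exists n x, [/\ sdd_returns L delta eps O x0 n x,
     goldstein_stationary delta eps f x &
     exists2 m, (n <= m.+2)%N & m%:R * (delta * sdd_sdec L eps) <= f x0 - f x]) \/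
  exists x g, [/\ iter k (sdd_step L delta eps O) (sdd_init O x0) = Running k.+1 x (f x) g,
    clarke_subdiff f x g & k%:R * (delta * sdd_sdec L eps) <= f x0 - f x].
Proof.
move=> lip L0 delta0 eps0 s0 hO; elim=> [|k [|[x [g [run xg dec]]]]]; [right| by left|].
  exists x0, (O 0%N x0).2; have [e /set_mem gO] := hO 0%N x0; split=> //.
    by rewrite /= /sdd_init -e; case: (O 0%N x0).
  by rewrite mul0r subrr.
have stepE : iter k.+1 (sdd_step L delta eps O) (sdd_init O x0) =
  sdd_step L delta eps O (Running k.+1 x (f x) g) by rewrite iterS run.
move: stepE; rewrite [in RHS]/sdd_step; case: ifPn => [small stepE|].
  left; exists k.+1, x; split; first by exists k.+1.
    apply: (goldstein_stationary_near _ _ _ _ x g) => //.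
    by rewrite /eball /= subrr -(scale0r 0) enormZ normr0 mul0r ltW.
  by exists k.
rewrite -ltNge => big; set y := x - _.
case E: (O k.+1 y) => [b gy]; have [/= b_eq /set_mem /= gyO] := hO k.+1 y.
rewrite E /= in b_eq gyO; rewrite b_eq; case: ifPn => [flat stepE|].
  left; exists k.+2, x; split; first by exists k.+1.
    exact: (goldstein_stationary_of_small_decrease f L delta eps x g).
  by exists k.
rewrite -ltNge => steep stepE; right; exists y, gy; split=> //.
rewrite -natr1 mulrDl mul1r; lra.
Qed.

Theorem proposition5p3 (R : realType) (d : nat) (L Delta delta eps : R)
    (x0 : 'rV[R]_d) (hd : (1 <= d)%N)
    (hL : 0 < L) (hDelta : 0 < Delta) (hdelta : 0 < delta)
    (heps : L / Num.sqrt 2 < eps) (hepsL : eps < L)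
    (f : 'rV[R]_d -> R) (hf : fclass L Delta x0 f)
    (O : oracle R d) (hO : valid_oracle f O) :
  exists (n : nat) (x : 'rV[R]_d),
    [/\ sdd_returns L delta eps O x0 n x,
        goldstein_stationary delta eps f x
      & n%:R <= 2 + Delta * L / (delta * (2 * eps ^+ 2 - L ^+ 2))].
Proof.
have [lip f_lb f_gap] := hf.
have eps0 : 0 < eps by apply: le_lt_trans heps; rewrite divr_ge0 ?sqrtr_ge0 ?ltW.
have s0 : 0 < 2 * eps ^+ 2 - L ^+ 2.
  move: heps; rewrite ltr_pdivrMr ?sqrtr_gt0// => heps.
  have : L ^+ 2 < (eps * Num.sqrt 2) ^+ 2.
    by rewrite ltr_pXn2r ?nnegrE ?mulr_ge0 ?sqrtr_ge0 ?(ltW hL) ?(ltW eps0).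
  by rewrite exprMn sqr_sqrtr//; lra.
have ds0 : 0 < delta * sdd_sdec L eps by rewrite mulr_gt0// divr_gt0.
have budget (m : nat) x : m%:R * (delta * sdd_sdec L eps) <= f x0 - f x ->
    m%:R <= Delta * L / (delta * (2 * eps ^+ 2 - L ^+ 2)).
  have : inf (range f) <= f x by apply: ge_inf => //; exists x.
  have -> : Delta * L / (delta * (2 * eps ^+ 2 - L ^+ 2)) =
      Delta / (delta * sdd_sdec L eps).
    by rewrite /sdd_sdec; field; rewrite !gt_eqF.
  rewrite ler_pdivlMr//; lra.
(* One iteration more than the decrease budget allows: the run has stopped. *)
pose k := (Num.trunc (Delta * L / (delta * (2 * eps ^+ 2 - L ^+ 2)))).+1.
have [] := sdd_progress L delta eps f O x0 lip hL hdelta eps0 (ltW s0) hO k.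
  move=> [n [x [ret stat [m nm /budget mle]]]]; exists n, x; split=> //.
  have : n%:R <= m.+2%:R :> R by rewrite ler_nat.
  by rewrite -addn2 natrD; lra.
move=> [x [g [_ _ /budget]]]; rewrite leNgt => /negP[].
exact: truncnS_gt.
Qed.
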